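(* Let $V=\{1,\ldots,n\}=C_1\cup C_2\cup\cdots\cup C_k$ with $C_i\cap C_j=\emptyset$ for $i\ne j$ be a partition of the vertex set into nonempty blocks, let $u_j\in\mathbb{R}^n$ be the indicator vector of $C_j$, and let $U=[u_1,u_2,\ldots,u_k]\in\mathbb{R}^{n\times k}$. Let $M\in\mathbb{R}^{n\times n}$ satisfy $MU=0$. Then $$\operatorname{span}\{u_1,u_2,\ldots,u_k\}\subseteq\ker(M),$$ and consequently $$\dim\ker(M)\ge k .$$ If, in addition, $M$ is a graph Laplacian, then the graph associated with $M$ has at least $k$ connected components.
   Context: The indicator vector $u_j$ of $C_j$ has entries $(u_j)_i=1$ if $i\in C_j$ and $0$ otherwise. A (weighted) graph Laplacian on $V=\{1,\ldots,n\}$ is a matrix of the form $D-W$, where $W=[w_{ij}]\in\mathbb{R}^{n\times n}$ is symmetric with $w_{ij}\ge 0$ for $i\ne j$ and $w_{ii}=0$, and $D=\operatorname{diag}(d_1,\ldots,d_n)$ with $d_i=\sum_j w_{ij}$. Equivalently, it is a symmetric matrix $M$ with $M\mathbf{1}_n=0$ (where $\mathbf{1}_n$ is the all-ones vector) and $M_{ij}\le 0$ for $i\neq j$. The graph associated with a graph Laplacian $M$ is the weighted undirected graph on $V$ with edge weights $-M_{ij}$ for $i\neq j$; vertices $i\ne j$ are adjacent iff $-M_{ij}>0$. *)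

(* Defs.v *)
From mathcomp Require Import all_boot all_order all_algebra.
From mathcomp Require Import reals.

Set Implicit Arguments.
Unset Strict Implicit.
Unset Printing Implicit Defensive.

Import Order.TTheory GRing.Theory Num.Theory.

Local Open Scope ring_scope.

Definition indicator (R : realType) (n : nat) (A : {set 'I_n}) : 'cV[R]_n :=
  \col_i (i \in A)%:R.

Definition indicator_mx (R : realType) (n k : nat) (C : 'I_k -> {set 'I_n}) :
    'M[R]_(n, k) :=
  \matrix_(i, j) indicator R (C j) i 0.

(* [kermx] and the %MS operations concern row vectors ([v *m M = 0]); the
   kernel meant here is that of the map [x |-> M *m x] on column vectors. *)
Definition colker (R : realType) (m n : nat) (M : 'M[R]_(m, n)) :
    {vspace 'cV[R]_n} :=
  lker (linfun (mulmx M : 'cV[R]_n -> 'cV[R]_m)).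

Lemma mem_colker (R : realType) (m n : nat) (M : 'M[R]_(m, n)) (x : 'cV[R]_n) :
  (x \in colker M) = (M *m x == 0).
Proof. by rewrite memv_ker lfunE. Qed.

Definition degree_mx (R : realType) (n : nat) (W : 'M[R]_n) : 'M[R]_n :=
  diag_mx (\row_i \sum_j W i j).

Definition graph_laplacian (R : realType) (n : nat) (M : 'M[R]_n) : Prop :=
  exists W : 'M[R]_n,
    [/\ W^T = W,
        forall i j : 'I_n, i != j -> 0 <= W i j,
        forall i : 'I_n, W i i = 0
      & M = degree_mx W - W].

Definition edge_weight (R : realType) (n : nat) (M : 'M[R]_n) (i j : 'I_n) : R :=
  if i == j then 0 else - M i j.

Definition adjacent (R : realType) (n : nat) (M : 'M[R]_n) : rel 'I_n :=
  fun i j => 0 < edge_weight M i j.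

(* [n_comp] counts connected components only when reachability is symmetric,
   which is the case for graph Laplacians. *)
Definition num_components (R : realType) (n : nat) (M : 'M[R]_n) : nat :=
  n_comp (adjacent M) 'I_n.

Lemma adjacent_connect_sym (R : realType) (n : nat) (M : 'M[R]_n) :
  graph_laplacian M -> connect_sym (adjacent M).
Proof.
case=> W [Wsym _ _ ->]; apply: sym_connect_sym => i j.
rewrite /adjacent /edge_weight (eq_sym j i); case: (eqVneq i j) => // neq_ij.
have neq_ji : j != i by rewrite eq_sym.
by rewrite !mxE (negPf neq_ij) (negPf neq_ji) -{2}Wsym mxE.
Qed.

(* Main.v *)
(** For [i] outside [C j], the [i]-th entry of [M *m indicator R (C j) = 0] is a
    sum of nonpositive entries of a Laplacian, so all of them vanish: no edge
    leaves a block, and representatives of distinct blocks lie in distinct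
    connected components. *)
Require Import Defs.
From mathcomp Require Import all_boot all_order all_algebra.
From mathcomp Require Import reals.

Import Order.TTheory GRing.Theory Num.Theory.

Local Open Scope ring_scope.

Lemma col_indicator_mx (R : realType) (n k : nat) (C : 'I_k -> {set 'I_n})
    (j : 'I_k) :
  col j (indicator_mx R C) = indicator R (C j).
Proof. by apply/colP => i; rewrite !mxE. Qed.

(** Evaluating a vanishing combination at a point of [C j] isolates the coefficient [c j], since by
    disjointness no other indicator is nonzero there. *)
Lemma free_indicators (R : realType) (n k : nat) (C : 'I_k -> {set 'I_n}) :
    (forall j, C j != set0) -> (forall i j, i != j -> C i :&: C j = set0) ->
  free [seq indicator R (C j) | j <- enum 'I_k].
Proof.
move=> C_neq0 C_disj.
pose X := [tuple indicator R (C j) | j < k].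
(* [freeP] is stated for tuples, so the list is recast as one; the two agree by computation. *)
rewrite -[[seq _ | _ <- _]]/(tval X).
apply/freeP => c sum0 j.
have /set0Pn [i iCj] := C_neq0 j.
move/colP/(_ i): sum0; rewrite summxE (bigD1 j) // big1 => [|l neq_lj].
  by rewrite -tnth_nth tnth_mktuple !mxE iCj mulr1 /= addr0.
rewrite -(tnth_nth 0 X l) tnth_mktuple !mxE; case: (boolP (i \in C l)) => [iCl|_].
  by have := C_disj l j neq_lj; move/setP/(_ i); rewrite !inE iCl iCj.
by rewrite mulr0.
Qed.

Lemma graph_laplacian_le0 (R : realType) (n : nat) (M : 'M[R]_n) (i j : 'I_n) :
  graph_laplacian M -> i != j -> M i j <= 0.
Proof.
case=> W [_ W_ge0 _ ->] neq_ij.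
by rewrite !mxE (negPf neq_ij) mulr0n add0r oppr_le0 W_ge0.
Qed.

Lemma indicator_ker_closed (R : realType) (n : nat) (M : 'M[R]_n)
    (A : {set 'I_n}) :
  graph_laplacian M -> M *m indicator R A = 0 -> closed (adjacent M) A.
Proof.
move=> lapM MA0; have symM := adjacent_connect_sym lapM.
(* As connectedness is symmetric, it is enough that no edge enters [A] from outside: the complement
   is then closed, hence so is [A]. *)
suff noedge x y : x \notin A -> y \in A -> ~~ adjacent M x y.
  have closedC : closed (adjacent M) [predC A].
    apply: (intro_closed symM) => x y exy xA; rewrite inE.
    by apply: contraL exy; apply: noedge.
  by move=> x y /closedC; rewrite !inE => /negb_inj.
move=> xA yA; have neq_xy : x != y by apply: contraNneq xA => ->.
(* This sum is minus the [x]-th entry of [M *m indicator R A]. *)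
have sum0 : \sum_(l in A) - M x l = 0.
  transitivity (- (M *m indicator R A) x 0); last by rewrite MA0 mxE oppr0.
  rewrite sumrN big_mkcond mxE; congr (- _); apply: eq_bigr => l _; rewrite mxE.
  by case: (l \in A); rewrite ?mulr1 ?mulr0.
(* As [x] lies outside [A], the diagonal entry [M x x] is absent and every summand is
   nonnegative. *)
have /psumr_eq0P/(_ sum0)/(_ y yA) Mxy0 l : l \in A -> 0 <= - M x l.
  move=> lA; rewrite oppr_ge0 graph_laplacian_le0 //.
  by apply: contraNneq xA => ->.
by rewrite /adjacent /edge_weight (negPf neq_xy) Mxy0 ltxx.
Qed.

(** A closed set contains the root of each of its points, so a root can be picked in every [C j];
    disjointness makes this choice injective into the roots, which [n_comp] counts. *)
Lemma leq_n_comp_closed (T : finType) (e : rel T) (k : nat)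
    (C : 'I_k -> {set T}) :
    connect_sym e -> (forall j, closed e (C j)) -> (forall j, C j != set0) ->
    (forall i j, i != j -> C i :&: C j = set0) ->
  (k <= n_comp e T)%N.
Proof.
move=> sym_e closC C_neq0 C_disj.
have repP j : exists x, x \in C j by apply/set0Pn.
pose r j := fingraph.root e (xchoose (repP j)).
have rC j : r j \in C j.
  rewrite -(closed_connect (closC j) (connect_root e _)).
  exact: (xchooseP (repP j)).
have r_inj : injective r.
  move=> i j eq_r; apply/eqP; apply: contraT => /C_disj/setP/(_ (r i)).
  by rewrite !inE rC eq_r rC.
rewrite -[k in (k <= _)%N]card_ord -(card_codom r_inj); apply/subset_leq_card.
by apply/subsetP => _ /codomP[j ->]; rewrite !inE roots_root.
Qed.

Theorem theorem5p1 (R : realType) (n k : nat) (C : 'I_k -> {set 'I_n})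
    (C_neq0 : forall j : 'I_k, C j != set0)
    (C_disj : forall i j : 'I_k, i != j -> C i :&: C j = set0)
    (C_cover : \bigcup_(j < k) C j = [set: 'I_n])
    (M : 'M[R]_n)
    (MU0 : M *m indicator_mx R C = 0) :
  [/\ (<<[seq indicator R (C j) | j <- enum 'I_k]>> <= colker M)%VS,
      (k <= \dim (colker M))%N
    & graph_laplacian M -> (k <= num_components M)%N].
Proof.
have MC0 j : M *m indicator R (C j) = 0.
  by rewrite -col_indicator_mx colE mulmxA MU0 mul0mx.
have span_ker : (<<[seq indicator R (C j) | j <- enum 'I_k]>> <= colker M)%VS.
  by apply/span_subvP => _ /mapP[j _ ->]; rewrite mem_colker MC0.
split=> // [|lapM].
  (* The independent indicators span a space of dimension [k] inside the kernel. *)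
  have /eqP dimC := free_indicators R n k C C_neq0 C_disj.
  by rewrite size_map size_enum_ord in dimC; rewrite -{1}dimC dimvS.
apply: leq_n_comp_closed (adjacent_connect_sym lapM) _ C_neq0 C_disj => j.
exact: indicator_ker_closed lapM (MC0 j).
Qed.
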